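(* Let there be $n$ buyers and $m$ datasets; buyer $i\in[n]$ has budget $b_i\in\mathbb{R}_{\ge0}$ and linear valuation $v_i(\mathbf{x})=\sum_{j=1}^m\tau_{i,j}x_j$ with $\tau_{i,j}\in\mathbb{R}_{\ge0}$. For $j\in[m]$ let $S_j=\{\tau_{i,j}:i\in[n]\}$. For each $j$ let $p_j:[0,1]\to\mathbb{R}_{\ge0}$ be a monotone lower-continuous pricing function (with $p_j(0)=0$), let $\hat p_j=\mathrm{disc}(\mathrm{conv}(p_j),S_j)$, and let $\mathbf{p}(\mathbf{x})=\sum_j p_j(x_j)$, $\hat{\mathbf{p}}(\mathbf{x})=\sum_j\hat p_j(x_j)$. Then $r(\hat{\mathbf{p}}\mid v_i,b_i)\ge r(\mathbf{p}\mid v_i,b_i)$ for every $i\in[n]$, and each $\hat p_j$ is monotone, continuous, convex and piecewise linear.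
   Context: Pricing function, $F$, $u^*$, $\mathrm{Dem}$ and revenue: a pricing function is a monotone $\mathbf{p}:[0,1]^m\to\mathbb{R}_{\ge0}$ with $\mathbf{p}(\mathbf{0})=0$; for valuation $v$ and budget $b\in\mathbb{R}_{\ge0}\cup\{\infty\}$, $F(\mathbf{p}\mid b)=\{\mathbf{x}:\mathbf{p}(\mathbf{x})\le b\}$, $u^*=\sup_{\mathbf{x}\in F}(v(\mathbf{x})-\mathbf{p}(\mathbf{x}))$, $\mathrm{Dem}(\mathbf{p}\mid v,b)=\{\mathbf{x}\in F: v(\mathbf{x})-\mathbf{p}(\mathbf{x})=u^*\}$, $r(\mathbf{p}\mid v,b)=\sup_{\mathbf{x}\in\mathrm{Dem}}\mathbf{p}(\mathbf{x})$. Lower-continuity of $f$ at $\hat x$: $f(\hat x)=\sup_{\delta>0}\inf_{|x-\hat x|\le\delta, x\in[0,1]}f(x)$. Convex hull of a function $f:[0,1]^m\to\mathbb{R}$: $\mathrm{conv}(f)(\mathbf{x})=\inf U_f(\mathbf{x})$, where $U_f(\mathbf{x})$ is the set of $y\in\mathbb{R}$ for which there exist $k\in\mathbb{N}$, $\lambda\in\Delta_k=\{\lambda\in[0,1]^k:\sum\lambda_i=1\}$, and $\mathbf{x}^{(1)},\dots,\mathbf{x}^{(k)}\in[0,1]^m$ with $\mathbf{x}=\sum_i\lambda_i\mathbf{x}^{(i)}$ and $y\ge\sum_i\lambda_if(\mathbf{x}^{(i)})$. For convex $f:[0,1]\to\mathbb{R}$, the left derivative is $f'(x)=\sup_{\delta\in(0,x]}(f(x)-f(x-\delta))/\delta$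 for $x\in(0,1]$ and $f'(0)=-\infty$; for $\beta\in\mathbb{R}$, $\ell(f\mid\beta)=\max\{x\in[0,1]:f'(x)\le\beta\}$. Piecewise-linear functions: for non-decreasing $\mathbf{z}\in[0,1]^{k-1}$ and $\boldsymbol\alpha\in\mathbb{R}^k$, with $z_0=0$, $\mathrm{plin}(\mathbf{z},\boldsymbol\alpha)$ is the function $f:[0,1]\to\mathbb{R}$ with $f(0)=0$ and, for $x>0$, $f(x)=\sum_{j=1}^{i-1}\alpha_j(z_j-z_{j-1})+\alpha_i(x-z_{i-1})$ where $i\in[k]$ is the largest index with $z_{i-1}<x$. Piecewise-linearization: for continuous convex $f:[0,1]\to\mathbb{R}$ and a finite set $S=\{\alpha_1<\dots<\alpha_k\}$, set $z_i=\ell(f\mid\alpha_i)$ for $i\in[k-1]$ and $\mathrm{disc}(f,S)=f(0)+\mathrm{plin}(\mathbf{z},\boldsymbol\alpha)$. *)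

(* Defs.v *)
From HB Require Import structures.
From mathcomp Require Import all_boot all_order all_algebra.
From mathcomp Require Import all_classical all_reals all_analysis.
Set Implicit Arguments. Unset Strict Implicit. Unset Printing Implicit Defensive.
Import Order.TTheory GRing.Theory Num.Theory.
Import numFieldNormedType.Exports.
Local Open Scope classical_set_scope.
Local Open Scope ring_scope.

Section Defs.
Variable R : realType.

Definition nondecr01 (f : R -> R) : Prop :=
  forall x y, 0 <= x -> x <= y -> y <= 1 -> f x <= f y.

Definition pricing1 (f : R -> R) : Prop :=
  [/\ nondecr01 f, f 0 = 0 & forall x, 0 <= x <= 1 -> 0 <= f x].

Definition lower_cont (f : R -> R) (xh : R) : Prop :=
  (f xh)%:E =
  ereal_sup [set ereal_inf [set (f x)%:E | x in
                 [set x | `|x - xh| <= d /\ 0 <= x <= 1]] | d in [set d | 0 < d]].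

Definition convex01 (f : R -> R) : Prop :=
  forall x y t, 0 <= x <= 1 -> 0 <= y <= 1 -> 0 <= t <= 1 ->
    f (t * x + (1 - t) * y) <= t * f x + (1 - t) * f y.

Definition piecewise_linear01 (f : R -> R) : Prop :=
  exists (k : nat) (t : nat -> R),
    [/\ t 0%N = 0, t k = 1, (forall i, (i < k)%N -> t i <= t i.+1) &
        forall i, (i < k)%N -> exists a c : R,
          forall x, t i <= x <= t i.+1 -> f x = a * x + c].

Definition Uset (f : R -> R) (x : R) : set R :=
  [set y | exists (k : nat) (lam xs : 'I_k -> R),
     [/\ (forall i, 0 <= lam i <= 1), \sum_(i < k) lam i = 1,
         (forall i, 0 <= xs i <= 1), x = \sum_(i < k) lam i * xs i &
         \sum_(i < k) lam i * f (xs i) <= y]].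

Definition convhull1 (f : R -> R) (x : R) : R := inf (Uset f x).

Definition leftder (f : R -> R) (x : R) : \bar R :=
  if x <= 0 then -oo%E
  else ereal_sup [set ((f x - f (x - d)) / d)%:E | d in [set d | 0 < d <= x]].

(* ell(f | beta) = max {x in [0,1] : f'(x) <= beta}  (taken as a sup) *)
Definition ell (f : R -> R) (beta : R) : R :=
  sup [set x | 0 <= x <= 1 /\ (leftder f x <= beta%:E)%E].

(* plin(z, alpha) with k pieces; indices 1-based: alpha 1..alpha k,
   z 1..z (k-1), and z_0 = 0. *)
Definition plin (k : nat) (z alpha : nat -> R) (x : R) : R :=
  let zz j := if j == 0%N then 0 else z j in
  if x <= 0 then 0 else
  let i := \big[maxn/0%N]_(1 <= i < k.+1 | zz i.-1 < x) i in
  \sum_(1 <= j < i) alpha j * (zz j - zz j.-1) + alpha i * (x - zz i.-1).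

(* disc(f, S) for a finite set S given as a list (duplicates/order irrelevant):
   alpha_1 < ... < alpha_k are the sorted elements of S, z_i = ell(f | alpha_i) *)
Definition disc (f : R -> R) (S : seq R) (x : R) : R :=
  let s := sort <=%R (undup S) in
  let alpha i := nth 0 s i.-1 in
  f 0 + plin (size s) (fun i => ell f (alpha i)) alpha x.

Definition cube (m : nat) : set ('I_m -> R) :=
  [set x | forall j, 0 <= x j <= 1].

Definition Feas (m : nat) (p : ('I_m -> R) -> R) (b : R) : set ('I_m -> R) :=
  [set x | cube x /\ p x <= b].

Definition ustar (m : nat) (p v : ('I_m -> R) -> R) (b : R) : \bar R :=
  ereal_sup [set (v x - p x)%:E | x in Feas p b].

Definition Dem (m : nat) (p v : ('I_m -> R) -> R) (b : R) : set ('I_m -> R) :=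
  [set x | Feas p b x /\ (v x - p x)%:E = ustar p v b].

Definition revenue (m : nat) (p v : ('I_m -> R) -> R) (b : R) : \bar R :=
  ereal_sup [set (p x)%:E | x in Dem p v b].

Definition linval (m : nat) (t : 'I_m -> R) (x : 'I_m -> R) : R :=
  \sum_(j < m) t j * x j.

End Defs.

(* Main.v *)
Require Import Defs.
From HB Require Import structures.
From mathcomp Require Import all_boot all_order all_algebra.
From mathcomp Require Import all_classical all_reals all_analysis.
From mathcomp Require Import ring lra.
Set Implicit Arguments. Unset Strict Implicit. Unset Printing Implicit Defensive.
Import Order.TTheory GRing.Theory Num.Theory.
Import numFieldNormedType.Exports.
Local Open Scope classical_set_scope.
Local Open Scope ring_scope.

(* Fix a buyer with slopes t_j and let L_j be the largest maximizer of the
   unbudgeted utility t_j x - p_j(x).  Then ell(conv(p_j) | t_j) = L_j, so L_j is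
   a breakpoint of phat_j where the slope of phat_j crosses t_j; hence L_j is also
   optimal for phat_j, and summing the tangent inequalities at the breakpoints
   gives phat_j(L_j) >= p_j(L_j).  Under p the buyer never buys more than L_j of
   dataset j.  If L is affordable under phat, the buyer can choose it and pays at
   least as much as under p.  Otherwise some optimal bundle exhausts the budget:
   moving from any optimum y towards max(y, L) never loses utility while the
   price crosses b continuously. *)

(** * Lower continuity and largest utility maximizers *)

Lemma lower_cont_near (R : realType) (f : R -> R) (x e : R) :
  lower_cont f x -> 0 < e ->
  exists2 d, 0 < d &
    forall y, `|y - x| <= d -> 0 <= y <= 1 -> f x - e <= f y.
Proof.
move=> lsc e0.
have : ((f x - e)%:E < (f x)%:E)%E by rewrite lte_fin; lra.
rewrite lsc => /ereal_sup_gt[_ [d d0 <-] lt_inf]; exists d => // y yd y01.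
rewrite -lee_fin; apply/ltW/(lt_le_trans lt_inf).
by apply: ereal_inf_lbound; exists y.
Qed.

(* The last clause makes [xs] the largest maximizer, with a uniform gap that
   survives passing from [p] to its convex hull. *)
Definition demand_point (R : realType) (p : R -> R) (t xs : R) : Prop :=
  [/\ 0 <= xs <= 1,
      forall x, 0 <= x <= 1 -> t * x - p x <= t * xs - p xs &
      forall c, xs < c -> exists2 e, 0 < e &
        forall x, c <= x <= 1 -> t * x - p x <= t * xs - p xs - e].

(* [xs] is the last point near which, or to the right of which, the utility
   comes arbitrarily close to its supremum; lower continuity of [p] makes the
   supremum attained there. *)
Lemma demand_point_exists (R : realType) (p : R -> R) (t : R) :
  pricing1 p -> (forall x, 0 <= x <= 1 -> lower_cont p x) -> 0 <= t ->
  exists xs, demand_point p t xs.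
Proof.
move=> [_ p0 pge0] lsc t0.
pose g x := t * x - p x.
pose G := [set g x | x in [set x | 0 <= x <= 1]].
have ubG : has_ubound G.
  exists t => _ [x /= x01 <-]; rewrite /g; have := pge0 x x01.
  have : t * x <= t * 1 by apply: ler_wpM2l => //; lra.
  lra.
have nG : G !=set0 by exists (g 0), 0 => //=; lra.
pose M := sup G.
have gM x : 0 <= x <= 1 -> g x <= M.
  by move=> ?; apply: ub_le_sup => //; exists x.
pose A := [set x | 0 <= x <= 1 /\
  forall e, 0 < e -> exists2 y, x <= y <= 1 & M - e < g y].
have A0 : A 0.
  split; first by lra.
  move=> e e0; have [|_ [y /= ? <-] ?] := sup_adherent e0 (E := G).
    by split.
  by exists y.
have ubA : has_ubound A by exists 1 => x [/andP[]].
have nA : A !=set0 by exists 0.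
have x0 : 0 <= sup A by apply: ub_le_sup.
have x1 : sup A <= 1 by apply: ge_sup => // x [/andP[]].
set xs := sup A in x0 x1.
have gap c : xs < c -> exists2 e, 0 < e &
    forall x, c <= x <= 1 -> g x <= M - e.
  move=> xc; apply: contrapT => nex.
  suff Ac : A c by have := ub_le_sup ubA Ac; rewrite -/xs; lra.
  have key e : 0 < e -> exists2 y, c <= y <= 1 & M - e < g y.
    move=> e0; apply: contrapT => ney; apply: nex; exists e => // x xc1.
    by rewrite leNgt; apply/negP => gx; apply: ney; exists x.
  split; last exact: key.
  by have [y] := key 1 ltr01; lra.
have gxs : g xs = M.
  apply/eqP; rewrite eq_le gM ?x0 ?x1//= leNgt; apply/negP => lt_gM.
  (* A third of the deficit: near [xs], [p] drops by at most [e] and the linear term gains at most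
     [e], so [g] stays at least [e] below [M]. *)
  have [e e0 Me] : exists2 e, 0 < e & M = t * xs - p xs + 3 * e.
    by exists ((M - g xs) / 3); rewrite /g in lt_gM *; lra.
  have [d d0 Hd] := lower_cont_near (lsc xs (introT andP (conj x0 x1))) e0.
  (* [t + 1] keeps the divisor positive when [t] is 0. *)
  pose d' := Num.min d (e / (t + 1)).
  have d'0 : 0 < d' by rewrite lt_min d0 divr_gt0//; lra.
  have near y : `|y - xs| <= d' -> 0 <= y <= 1 -> g y <= M - e.
    rewrite le_min => /andP[yd ye] y01.
    have := Hd y yd y01.
    have : t * (y - xs) <= e.
      have h1 : (t + 1) * `|y - xs| <= e.
        by rewrite mulrC -ler_pdivlMr//; lra.
      have h2 : t * (y - xs) <= t * `|y - xs| by rewrite ler_wpM2l// ler_norm.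
      have := normr_ge0 (y - xs); lra.
    rewrite /g; lra.
  (* A point of [A] within [d'] of [xs] has almost optimal points [y] to its right; [near] and [far]
     exclude them on either side of [xs + d']. *)
  have [|e2 e20 far] := gap (xs + d'); first by lra.
  have [|c [c01 Ac] cd] := sup_adherent d'0 (E := A); first by split.
  rewrite -/xs in cd.
  have [|y cy yM] := Ac (Num.min e e2); first by rewrite lt_min e0.
  have [ylt|yge] := leP y (xs + d').
  - have : g y <= M - e by apply: near; rewrite ?ler_distl; lra.
    by case: (lerP e e2) yM; lra.
  - have : g y <= M - e2 by apply: far; lra.
    by case: (lerP e e2) yM; lra.
exists xs; split; first by rewrite x0.
- by move=> x /gM; rewrite -/(g x) -/(g xs) gxs.
- by move=> c /gap[e e0 H]; exists e => // x /H; rewrite -/(g x) -/(g xs) gxs.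
Qed.

(** * The convex hull through affine minorants, and its [ell] *)

Lemma Uset_ge_affine (R : realType) (f : R -> R) (a c x y : R) :
  (forall u, 0 <= u <= 1 -> a * u + c <= f u) -> Uset f x y -> a * x + c <= y.
Proof.
move=> af [k [lam [xs [lam01 suml xs01 -> le_y]]]].
apply: le_trans le_y; rewrite mulr_sumr -[X in _ + X]mulr1 -suml mulr_sumr.
rewrite -big_split /=; apply: ler_sum => i _.
rewrite (_ : _ + _ = lam i * (a * xs i + c)); last by ring.
by apply: ler_wpM2l (af _ (xs01 i)); have /andP[] := lam01 i.
Qed.

Lemma Uset_self (R : realType) (f : R -> R) (x : R) :
  0 <= x <= 1 -> Uset f x (f x).
Proof.
move=> x01; exists 1%N, (fun=> 1), (fun=> x).
by split => //; rewrite ?big_ord1 ?mul1r ?lexx ?ler01.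
Qed.

Lemma convhull1_ge_affine (R : realType) (f : R -> R) (a c x : R) :
  (forall u, 0 <= u <= 1 -> a * u + c <= f u) -> 0 <= x <= 1 ->
  a * x + c <= convhull1 f x.
Proof.
move=> af x01; apply: lb_le_inf; first by exists (f x); exact: Uset_self.
by move=> y; apply: Uset_ge_affine.
Qed.

(** The affine minorant bounds [Uset] from below, which makes [inf] a genuine infimum. *)
Lemma convhull1_le (R : realType) (f : R -> R) (a c x : R) :
  (forall u, 0 <= u <= 1 -> a * u + c <= f u) -> 0 <= x <= 1 ->
  convhull1 f x <= f x.
Proof.
move=> af x01; apply: ge_inf; last exact: Uset_self.
by exists (a * x + c) => y; apply: Uset_ge_affine.
Qed.

Lemma convhull1_0 (R : realType) (p : R -> R) : pricing1 p -> convhull1 p 0 = 0.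
Proof.
move=> [_ p0 pge0].
have p_ge u : 0 <= u <= 1 -> 0 * u + 0 <= p u.
  by rewrite mul0r addr0; exact: pge0.
have z01 : 0 <= (0 : R) <= 1 by rewrite lexx ler01.
apply/eqP; rewrite eq_le -{2}p0 (convhull1_le p_ge z01).
by have := convhull1_ge_affine p_ge z01; rewrite mul0r addr0.
Qed.

(** The line of slope [t] that supports [p] at [xs] also supports the hull there, so left difference
    quotients at [xs] are at most [t]. To the right of [xs] the uniform gap lifts the hull strictly
    above this line, so the left derivative exceeds [t]. *)
Lemma ell_convhull1 (R : realType) (p : R -> R) (t xs : R) :
  demand_point p t xs -> ell (convhull1 p) t = xs.
Proof.
move=> [xs01 maxp gap]; pose M := t * xs - p xs; pose f := convhull1 p.
have p_ge u : 0 <= u <= 1 -> t * u + - M <= p u.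
  by move=> /maxp; rewrite /M; lra.
have f_ge x : 0 <= x <= 1 -> t * x + - M <= f x.
  exact: convhull1_ge_affine.
have fxs : f xs = t * xs - M.
  have := f_ge _ xs01; have := convhull1_le p_ge xs01; rewrite -/f /M; lra.
have f_gt y : xs < y -> y <= 1 -> t * y - M < f y.
  move=> xy y1; pose c := (xs + y) / 2.
  have [|e e0 H] := gap c; first by rewrite /c; lra.
  (* The supporting line tilted about its point at [c]: it only goes down left of [c], and right of
     [c] it rises by at most [e], which the gap absorbs. *)
  suff : (t + e) * y + (- M - e * c) <= f y.
    have : 0 < e * (y - c) by apply: mulr_gt0 => //; rewrite /c; lra.
    lra.
  apply: convhull1_ge_affine; last by lra.
  move=> u u01; have [uc|cu] := lerP u c.
    have : e * (u - c) <= 0 by rewrite pmulr_rle0//; lra.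
    by have := p_ge u u01; lra.
  have : e * (u - c) <= e * 1 by apply: ler_wpM2l; rewrite ?ltW// /c; lra.
  have : t * u - p u <= M - e by apply: H; lra.
  lra.
set A := [set x | 0 <= x <= 1 /\ (leftder f x <= t%:E)%E].
rewrite /ell -/f -/A.
have Axs : A xs.
  split => //; rewrite /leftder; case: ifP => [_|/negbT]; first exact: leNye.
  rewrite -ltNge => xs0; apply: ge_ereal_sup => _ [d /= d0 <-].
  rewrite lee_fin ler_pdivrMr; last by lra.
  have : t * (xs - d) + - M <= f (xs - d) by apply: f_ge; lra.
  rewrite fxs; lra.
have ubA : ubound A xs.
  move=> y [y01 ldy]; rewrite leNgt; apply/negP => xy; move: ldy.
  rewrite /leftder; case: ifP => [? _|_]; first by lra.
  apply/negP; rewrite -ltNge.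
  (* The step [y - xs] reaches back exactly to the contact point. *)
  apply: (@lt_le_trans _ _ ((f y - f (y - (y - xs))) / (y - xs))%:E).
    rewrite lte_fin ltr_pdivlMr; last by lra.
    have : t * y - M < f y by apply: f_gt; lra.
    by rewrite subKr fxs; lra.
  by apply: ereal_sup_ubound; exists (y - xs) => //=; lra.
apply/eqP; rewrite eq_le ge_sup//=; last by exists xs.
by apply: ub_le_sup => //; exists xs.
Qed.

(** * Piecewise-linear functions as sums of hinges *)

(** For sorted [z], slopes [a 0, ..., a k] change at the breakpoints [z 0, ..., z (k-1)]. Weighting
    each hinge by its slope jump lets convexity, continuity and slope bounds be checked term by
    term. *)
Definition hinge_sum (R : realType) (k : nat) (a z : nat -> R) (x : R) : R :=
  a 0%N * x + \sum_(i < k) (a i.+1 - a i) * Num.max 0 (x - z i).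

(** By telescoping, [a i] is [a 0] plus the first [i] jumps. Those hinges are already active at [x]
    and contribute in full; the others never decrease. *)
Lemma hinge_sum_diff_ge (R : realType) (k : nat) (a z : nat -> R) i x y :
  (forall j, (j < k)%N -> a j <= a j.+1) -> (i <= k)%N ->
  (forall j, (j < i)%N -> z j <= x) -> x <= y ->
  a i * (y - x) <= hinge_sum k a z y - hinge_sum k a z x.
Proof.
move=> am ik zx xy.
have -> : a i = a 0%N + \sum_(j < k) (if (j < i)%N then a j.+1 - a j else 0).
  rewrite -big_mkcond -(big_ord_widen k (fun j => a j.+1 - a j) ik).
  by rewrite -(big_mkord xpredT (fun j => a j.+1 - a j)) telescope_sumr// subrKC.
rewrite /hinge_sum opprD addrACA -mulrBr mulrDl lerD2l -sumrB mulr_suml.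
apply: ler_sum => j _; rewrite -mulrBr; have := am j (ltn_ord j).
case: ifPn => [/zx zjx|_] dj.
  apply: ler_wpM2l; first by lra.
  by case: (lerP 0 (y - z j)); case: (lerP 0 (x - z j)); lra.
rewrite mul0r; apply: mulr_ge0; first by lra.
by case: (lerP 0 (y - z j)); case: (lerP 0 (x - z j)); lra.
Qed.

(** Dually, hinges from index [i] on are inactive up to [y], and the earlier ones grow at most at
    their full rate. *)
Lemma hinge_sum_diff_le (R : realType) (k : nat) (a z : nat -> R) i x y :
  (forall j, (j < k)%N -> a j <= a j.+1) -> (i <= k)%N ->
  (forall j, (i <= j < k)%N -> y <= z j) -> x <= y ->
  hinge_sum k a z y - hinge_sum k a z x <= a i * (y - x).
Proof.
move=> am ik zy xy.
have -> : a i = a 0%N + \sum_(j < k) (if (j < i)%N then a j.+1 - a j else 0).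
  rewrite -big_mkcond -(big_ord_widen k (fun j => a j.+1 - a j) ik).
  by rewrite -(big_mkord xpredT (fun j => a j.+1 - a j)) telescope_sumr// subrKC.
rewrite /hinge_sum opprD addrACA -mulrBr mulrDl lerD2l -sumrB mulr_suml.
apply: ler_sum => j _; rewrite -mulrBr; have := am j (ltn_ord j).
case: ifPn => [_|]; last rewrite -leqNgt => ij; move=> dj.
  apply: ler_wpM2l; first by lra.
  by case: (lerP 0 (y - z j)); case: (lerP 0 (x - z j)); lra.
rewrite mul0r; have zj := zy j (introT andP (conj ij (ltn_ord j))).
by rewrite !max_l ?subrr ?mulr0; lra.
Qed.

Lemma hinge_sum_convex (R : realType) (k : nat) (a z : nat -> R) :
  (forall j, (j < k)%N -> a j <= a j.+1) -> convex01 (hinge_sum k a z).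
Proof.
move=> am x y t _ _ /andP[t0 t1]; rewrite /hinge_sum !mulrDr addrACA !mulr_sumr.
apply: lerD; first by lra.
rewrite -big_split /=; apply: ler_sum => i _.
rewrite !(mulrCA _ (a i.+1 - a i)) -mulrDr; apply: ler_wpM2l.
  by rewrite subr_ge0 am.
have hx : t * (x - z i) <= t * Num.max 0 (x - z i).
  by apply: ler_wpM2l => //; rewrite le_max lexx orbT.
have hy : (1 - t) * (y - z i) <= (1 - t) * Num.max 0 (y - z i).
  by apply: ler_wpM2l; rewrite ?subr_ge0// le_max lexx orbT.
rewrite ge_max; apply/andP; split; last by lra.
by rewrite addr_ge0// mulr_ge0 ?subr_ge0// le_max lexx.
Qed.

Lemma hinge_sum_continuous (R : realType) (k : nat) (a z : nat -> R) :
  continuous (hinge_sum k a z).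
Proof.
move=> x; apply: cvgD; first exact: mulrl_continuous.
apply: cvg_big => [|i _]; first exact: add_continuous.
apply: cvgM; first exact: cvg_cst.
apply: (@continuous_max R R (fun=> 0) (fun x => x - z i) x); first exact: cvg_cst.
by apply: cvgB; [exact: cvg_id|exact: cvg_cst].
Qed.

Lemma hinge_sum_piecewise_linear (R : realType) (k : nat) (a z : nat -> R) :
  (forall j, (j < k)%N -> a j <= a j.+1) ->
  (forall i j, (i <= j < k)%N -> z i <= z j) ->
  (forall i, (i < k)%N -> 0 <= z i <= 1) ->
  piecewise_linear01 (hinge_sum k a z).
Proof.
move=> am zm z01.
(* The hinge points shifted by one, between the endpoints 0 and 1; on piece [i] the two slope bounds
   meet at [a i]. *)
pose t i := if i is j.+1 then if (j < k)%N then z j else 1 else 0.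
have tm i : (i < k.+1)%N -> t i <= t i.+1.
  case: i => [|i] /= ik; first by case: ifPn => // /z01/andP[].
  rewrite ltnS in ik; rewrite ik; case: ifPn => [ik1|_].
    by apply: zm; rewrite leqnSn.
  by have /andP[] := z01 _ ik.
exists k.+1, t; split => // [|i ik]; first by rewrite /= ltnn.
exists (a i), (hinge_sum k a z (t i) - a i * t i) => x /andP[tx xt].
suff : hinge_sum k a z x - hinge_sum k a z (t i) = a i * (x - t i) by lra.
apply/eqP; rewrite eq_le hinge_sum_diff_le ?hinge_sum_diff_ge//.
- case: i ik {tx xt} => // i ik j; rewrite /= (ik : (i < k)%N) => ji.
  by apply: zm; rewrite -(ltnS j) ji.
- move=> j /andP[ij jk]; apply: (le_trans xt); rewrite /= (leq_ltn_trans ij jk).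
  by apply: zm; rewrite ij.
Qed.

(** * From [plin] and [disc] to hinge sums *)

(** Summation by parts: slopes times interval lengths become slope jumps times distances to the
    breakpoints. *)
Lemma plin_closed_form (R : realType) (k : nat) (z alpha : nat -> R) (x : R) :
  \sum_(1 <= j < k.+1) alpha j *
      ((if j == 0%N then 0 else z j) - (if j.-1 == 0%N then 0 else z j.-1)) +
    alpha k.+1 * (x - (if k == 0%N then 0 else z k)) =
  alpha 1%N * x + \sum_(i < k) (alpha i.+2 - alpha i.+1) * (x - z i.+1).
Proof.
elim: k => [|k IH]; first by rewrite big_geq// big_ord0 add0r subr0 addr0.
rewrite big_nat_recr//= big_ord_recr /= addrA -IH -!addrA.
congr (_ + _); case: eqP => _; ring.
Qed.

Lemma bigmax_index_recr (k : nat) (P : pred nat) :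
  (\big[maxn/0]_(1 <= i < k.+2 | P i) i =
   if P k.+1 then k.+1 else \big[maxn/0]_(1 <= i < k.+1 | P i) i)%N.
Proof.
rewrite big_mkcond big_nat_recr// -big_mkcond; case: ifP => _; last exact: maxn0.
apply/maxn_idPr/leqW; rewrite big_nat_cond.
by apply/bigmax_leqP_seq => i _ /andP[/andP[_ +] _].
Qed.

Lemma plin_hinge_sum (R : realType) (k : nat) (z alpha : nat -> R) (x : R) :
  (forall i j, (0 < i <= j)%N -> (j <= k)%N -> z i <= z j) ->
  0 < x ->
  plin k.+1 z alpha x = hinge_sum k (fun i => alpha i.+1) (fun i => z i.+1) x.
Proof.
move=> zm x0; have z_lt_x i : (0 < i <= k)%N -> z k < x -> z i < x.
  by move=> ik; apply: le_lt_trans; apply: zm => //; have /andP[_] := ik.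
elim: k zm z_lt_x => [|k IH] zm z_lt_x.
  rewrite /plin leNgt x0 /= /hinge_sum big_ord0 bigmax_index_recr /= x0.
  by rewrite big_geq// add0r addr0 subr0.
have [zx|xz] := ltrP (z k.+1) x.
  rewrite /plin leNgt x0 bigmax_index_recr /= zx.
  have := plin_closed_form k.+1 z alpha x => /= ->.
  rewrite /hinge_sum; congr (_ + _); apply: eq_bigr => i _; congr (_ * _).
  by rewrite max_r// subr_ge0 (ltW (z_lt_x i.+1 (ltn_ord i) zx)).
rewrite /hinge_sum big_ord_recr /= addrA [X in _ + _ * X]max_l ?subr_le0//.
rewrite mulr0 addr0 -/(hinge_sum k (fun i => alpha i.+1) (fun i => z i.+1) x) -IH.
- by rewrite /plin leNgt x0 (bigmax_index_recr k.+1) /= ltNge xz /=.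
- by move=> i j ij jk; apply: zm => //; apply: leqW.
- by move=> i ik; apply: le_lt_trans; apply: zm.
Qed.

Lemma ell_mono (R : realType) (f : R -> R) (s t : R) :
  s <= t -> ell f s <= ell f t.
Proof.
move=> st; apply: sup_le.
- move=> x [x01 fx]; exists x; split => //.
  by split => //; apply: (le_trans fx); rewrite lee_fin.
(* The point 0 always qualifies, its left derivative being -oo. *)
- by exists 0; split; [rewrite lexx ler01|rewrite /leftder lexx leNye].
- split; last by exists 1 => x [/andP[]].
  by exists 0; split; [rewrite lexx ler01|rewrite /leftder lexx leNye].
Qed.

(** The truncation at 0 reflects that [plin] vanishes at every nonpositive argument. *)
Lemma disc_hinge_sum (R : realType) (f : R -> R) (S : seq R) (x : R) :
  let s := sort <=%R (undup S) in
  (forall t, t \in S -> 0 <= ell f t) ->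
  disc f S x =
  f 0 + hinge_sum (size s).-1 (nth 0 s) (fun i => ell f (nth 0 s i)) (Num.max 0 x).
Proof.
move=> s ell0; rewrite /disc -/s; congr (_ + _).
have [x0|x0] := lerP x 0.
  rewrite /plin x0 /hinge_sum mulr0 add0r big1// => i _.
  rewrite max_l ?mulr0// sub0r oppr_le0; apply: ell0.
  have : (i < size s)%N by apply: (leq_trans (ltn_ord i)); exact: leq_pred.
  by move=> /(mem_nth 0); rewrite mem_sort mem_undup.
(* Without pieces the maximal index in [plin] is 0, and the slope on both sides is the default 0 of
   [nth]. *)
case Es : (size s) => [|k].
  rewrite /hinge_sum big_ord0 /plin leNgt x0 /= [X in s`_X.-1 * _]big_geq//.
  by rewrite !big_geq// nth_default ?Es// !mul0r.
rewrite plin_hinge_sum// => i j /andP[i0 ij] jk; apply: ell_mono.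
apply: (sorted_leq_nth le_trans le_refl) => //.
- exact: sort_le_sorted.
- rewrite inE Es; apply: leq_ltn_trans (leq_pred i) _.
  by rewrite ltnS; exact: leq_trans jk.
- by rewrite inE Es; apply: leq_ltn_trans (leq_pred j) _; rewrite ltnS.
- by case: i j i0 ij {jk} => [|i] [|j].
Qed.

(** * Demand sets and revenue comparison *)

Lemma le_revenue (R : realType) (m : nat) (P Q v : ('I_m -> R) -> R) (b : R) :
  (forall x, Dem P v b x -> exists2 y, Dem Q v b y & P x <= Q y) ->
  (revenue P v b <= revenue Q v b)%E.
Proof.
move=> dom; apply: ge_ereal_sup => _ [x /dom[y Dy Pxy] <-].
apply: (@le_trans _ _ (Q y)%:E); first by rewrite lee_fin.
by apply: ereal_sup_ubound; exists y.
Qed.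

Lemma DemP (R : realType) (m : nat) (P v : ('I_m -> R) -> R) (b : R) x :
  Dem P v b x <->
  Feas P b x /\ forall y, Feas P b y -> v y - P y <= v x - P x.
Proof.
split=> [[Fx eqx]|[Fx maxx]]; split => //.
  move=> y Fy; rewrite -lee_fin eqx; apply: ereal_sup_ubound.
  by exists y.
apply/eqP; rewrite eq_le; apply/andP; split.
  by apply: ereal_sup_ubound; exists x.
by apply: ge_ereal_sup => _ [y Fy <-]; rewrite lee_fin maxx.
Qed.

Lemma utility_sumE (R : realType) (m : nat) (t : 'I_m -> R)
    (q : 'I_m -> R -> R) (x : 'I_m -> R) :
  linval t x - \sum_(j < m) q j (x j) = \sum_(j < m) (t j * x j - q j (x j)).
Proof. by rewrite sumrB. Qed.

Lemma continuous_sum (R : realType) (T : topologicalType) (m : nat)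
    (f : 'I_m -> T -> R) :
  (forall j, continuous (f j)) -> continuous (fun x => \sum_(j < m) f j x).
Proof.
by move=> cf x; apply: cvg_big => [|j _]; [exact: add_continuous|exact: cf].
Qed.

(** Extreme value theorem: the affordable part of the cube is compact and contains the zero bundle.
    Bundles are taken as row vectors to carry the topology. *)
Lemma Dem_nonempty (R : realType) (m : nat) (t : 'I_m -> R)
    (q : 'I_m -> R -> R) (b : R) :
  0 <= b -> (forall j, q j 0 = 0) -> (forall j, continuous (q j)) ->
  exists y, Dem (fun x => \sum_(j < m) q j (x j)) (linval t) b y.
Proof.
move=> b0 q0 cq.
pose C := [set w : 'rV[R]_m | forall j, `[(0 : R), 1]%classic (w ord0 j)].
have csep (g : 'I_m -> R -> R) : (forall j, continuous (g j)) ->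
    continuous (fun w : 'rV[R]_m => \sum_(j < m) g j (w ord0 j)).
  move=> cg; apply: continuous_sum => j w.
  by apply: continuous_comp; [exact: coord_continuous|exact: cg].
pose Q (w : 'rV[R]_m) := \sum_(j < m) q j (w ord0 j).
have cQ : continuous Q by exact: csep.
have cA : compact (C `&` [set w | Q w <= b]).
  apply: compact_closedI; last first.
    have cQ' : {in ~` Q @^-1` [set r | r <= b], continuous Q}.
      by move=> w _; exact: cQ.
    exact: (preimage_closed cQ' (@closed_le R b)).
  by apply: (@rV_compact R m (fun=> `[(0 : R), 1]%classic)) => j; exact: segment_compact.
pose f w := \sum_(j < m) (t j * (w : 'rV[R]_m) ord0 j - q j (w ord0 j)).
have cf : continuous f.
  apply: (csep (fun j r => t j * r - q j r)) => j r.
  by apply: cvgB; [exact: mulrl_continuous|exact: cq].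
have A0 : (C `&` [set w | Q w <= b]) !=set0.
  exists 0; split=> [j|]; rewrite /= ?mxE ?in_itv/= ?lexx ?ler01//.
  by rewrite /Q big1// => j _; rewrite mxE q0.
have [w] := compact_EVT_max A0 cA (continuous_subspaceT cf).
rewrite inE => -[Cw Qw] maxw; exists (fun j => w ord0 j); apply/DemP; split.
  by split => // j; have := Cw j; rewrite /= in_itv.
move=> y [Cy Qy]; rewrite !utility_sumE.
have := maxw (\row_j y j); rewrite inE /f.
under eq_bigr do rewrite mxE; apply; split => [j|].
  by rewrite /= mxE in_itv /=; exact: Cy.
by rewrite /= /Q; under eq_bigr do rewrite mxE.
Qed.

(** Truncating [x] at [L] stays affordable and loses utility in no coordinate, so optimality makes
    every gain zero; a coordinate above [L j] would gain strictly by the gap. *)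
Lemma demand_le_demand_point (R : realType) (m : nat) (t L : 'I_m -> R)
    (p : 'I_m -> R -> R) (b : R) x :
  (forall j, nondecr01 (p j)) -> (forall j, demand_point (p j) (t j) (L j)) ->
  Dem (fun x => \sum_(j < m) p j (x j)) (linval t) b x ->
  forall j, x j <= L j.
Proof.
move=> pm dL /DemP[[x01 Px] maxx] j.
pose y i := Num.min (x i) (L i).
pose u i := (t i * y i - p i (y i)) - (t i * x i - p i (x i)).
have u0 i : 0 <= u i.
  rewrite /u /y; have [_ maxL _] := dL i.
  by case: (lerP (x i) (L i)) => _; [rewrite subrr|rewrite subr_ge0 maxL].
have y01 : cube y.
  move=> i; rewrite /y; have [? _ _] := dL i; have := x01 i.
  by case: (lerP (x i) (L i)); lra.
have Fy : Feas (fun x => \sum_(j < m) p j (x j)) b y.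
  split => //; apply: (le_trans _ Px); apply: ler_sum => i _.
  have /andP[y0 _] := y01 i; have /andP[_ x1] := x01 i.
  by apply: pm => //; rewrite ge_min lexx.
have : \sum_i u i = 0.
  apply/eqP; rewrite eq_le sumr_ge0 ?andbT//.
  by rewrite sumrB subr_le0 -!utility_sumE maxx.
move=> /psumr_eq0P -/(_ (fun i _ => u0 i)) /(_ j isT) uj.
rewrite leNgt; apply/negP => Lx; have [_ _ gap] := dL j.
have [e e0 H] := gap _ Lx.
have /andP[_ xj1] := x01 j.
have : t j * x j - p j (x j) <= t j * L j - p j (L j) - e.
  by apply: H; rewrite lexx.
by move: uj; rewrite /u /y min_r ?(ltW Lx)//; lra.
Qed.

Lemma revenue_dominated (R : realType) (m : nat) (t L : 'I_m -> R)
    (p q : 'I_m -> R -> R) (b : R) :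
  0 <= b -> (forall j, nondecr01 (p j)) ->
  (forall j, demand_point (p j) (t j) (L j)) ->
  (forall j, nondecr01 (q j)) ->
  (forall j, q j 0 = 0) -> (forall j, continuous (q j)) ->
  (forall j, p j (L j) <= q j (L j)) ->
  (forall j x y, 0 <= x -> x <= y -> y <= L j ->
     q j y - q j x <= t j * (y - x)) ->
  (forall j x, L j <= x -> x <= 1 ->
     t j * (x - L j) <= q j x - q j (L j)) ->
  (revenue (fun x => \sum_(j < m) p j (x j))%R (linval t) b <=
   revenue (fun x => \sum_(j < m) q j (x j))%R (linval t) b)%E.
Proof.
move=> b0 pm dL qm q0 cq pq slope_le slope_ge; apply: le_revenue => x Dx.
have xL := demand_le_demand_point pm dL Dx.
have [[x01 Px] _] := Dx.
pose Q x := \sum_(j < m) q j (x j).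
have L01 j : 0 <= L j <= 1 by have [] := dL j.
have PQ : \sum_(j < m) p j (x j) <= Q L.
  apply: ler_sum => j _; apply: le_trans (pq j).
  by have /andP[? _] := x01 j; have /andP[_ ?] := L01 j; apply: pm.
(* If affordable, [L] is optimal: the slope conditions make each [L j] maximize its own unbudgeted
   utility. *)
have [QLb|bQL] := lerP (Q L) b.
  exists L => //; apply/DemP; split => // y [y01 _].
  rewrite !utility_sumE; apply: ler_sum => j _.
  have /andP[y0 y1] := y01 j; have [yL|/ltW Ly] := lerP (y j) (L j).
    by have := slope_le j _ _ y0 yL (lexx _); lra.
  by have := slope_ge j _ Ly y1; lra.
have [y Dy] := Dem_nonempty t b0 q0 cq.
(* The segment from [y] to [max y L] never loses utility, and its price passes
   from at most [b] to more than [b]. *)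
have [[y01 Qy] maxy] := (DemP _ _ _ _).1 Dy.
pose w s j := y j + s * (Num.max (y j) (L j) - y j).
have cw j : continuous (fun s => w s j).
  move=> s; apply: cvgD; first exact: cvg_cst.
  by apply: cvgM; [exact: cvg_id|exact: cvg_cst].
have cQw : {within `[0, 1], continuous (fun s => Q (w s))}.
  apply: continuous_subspaceT; apply: continuous_sum => j s.
  by apply: continuous_comp; [exact: cw|exact: cq].
have Qw0 : Q (w 0) <= b.
  by rewrite /w; under [w in Q w]funext do rewrite mul0r addr0.
have Qw1 : b <= Q (w 1).
  apply: (le_trans (ltW bQL)); apply: ler_sum => j _.
  rewrite /w mul1r subrKC; case: (lerP (y j) (L j)) => // Ly.
  have /andP[_ y1] := y01 j; have /andP[L0 _] := L01 j.
  by apply: qm => //; apply: ltW.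
have [|s] := IVT ler01 cQw (v := b).
  by rewrite ge_min le_max Qw0 Qw1 orbT.
rewrite in_itv /= => /andP[s0 s1] Qws.
exists (w s); last by rewrite -/(Q (w s)) Qws.
apply/DemP; split.
  split; last by rewrite -/(Q (w s)) Qws.
  move=> j; rewrite /w; have := y01 j; have := L01 j.
  set M := Num.max _ _ => Lj yj.
  have /andP[M0 M1] : 0 <= M <= 1 by rewrite /M; case: (lerP (y j) (L j)); lra.
  have := mulr_ge0 s0 M0; have := ler_wpM2l s0 M1.
  have s1' : 0 <= 1 - s by lra.
  have /andP[y0 y1] := yj.
  have := mulr_ge0 s1' y0; have := ler_wpM2l s1' y1; lra.
(* Only coordinates below [L j] move, and they stay below it, where [q j] has slope at most
   [t j]. *)
move=> z /maxy /le_trans; apply; rewrite !utility_sumE.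
apply: ler_sum => j _; rewrite /w; have /andP[y0 y1] := y01 j.
case: (lerP (y j) (L j)) => yL; last by rewrite subrr mulr0 addr0.
have yL' : 0 <= L j - y j by rewrite subr_ge0.
have := mulr_ge0 s0 yL'; have := ler_wpM2r yL' s1 => h1 h2.
have := slope_le j (y j) (y j + s * (L j - y j)) y0.
by move=> /(_ ltac:(lra) ltac:(lra)); lra.
Qed.

(** * The discretized hull: slopes, values and regularity *)

Lemma sorted_undup (R : realType) (S : seq R) i j :
  let s := sort <=%R (undup S) in
  (i <= j)%N -> (j < size s)%N -> s`_i <= s`_j.
Proof.
move=> s ij js; apply: (sorted_leq_nth le_trans le_refl) => //.
- exact: sort_le_sorted.
- exact: leq_ltn_trans js.
Qed.

(** Pairs every slope with its demand point. Only indices below [k] are hinges; [z k] is the demand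
    point of the last slope. *)
Lemma disc_convhull1_hinge_sum (R : realType) (p : R -> R) (S : seq R) :
  pricing1 p -> (forall x, 0 <= x <= 1 -> lower_cont p x) ->
  (forall u, u \in S -> 0 <= u) ->
  exists (k : nat) (a z : nat -> R),
  [/\ disc (convhull1 p) S = hinge_sum k a z \o Num.max 0,
      forall i, 0 <= a i,
      forall i j, (i <= j <= k)%N -> a i <= a j /\ z i <= z j,
      forall i, demand_point p (a i) (z i) &
      forall t, t \in S -> exists2 i, (i <= k)%N & t = a i].
Proof.
move=> pp lsc S0; pose s := sort <=%R (undup S).
have a0 i : 0 <= s`_i.
  have [si|si] := ltnP i (size s); last by rewrite nth_default.
  by apply: S0; move: (mem_nth 0 si); rewrite mem_sort mem_undup.
have dz t : 0 <= t -> demand_point p t (ell (convhull1 p) t).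
  by move=> /(demand_point_exists pp lsc)[xs dxs]; rewrite (ell_convhull1 dxs).
exists (size s).-1, (nth 0 s), (fun i => ell (convhull1 p) s`_i); split => //.
- apply: funext => x; rewrite disc_hinge_sum/= => [|t /S0 /dz[/andP[]]//].
  by rewrite (convhull1_0 pp) add0r.
- move=> i j /andP[ij js]; suff sij : s`_i <= s`_j by split => //; exact: ell_mono.
  have [s0|s0] := posnP (size s); first by rewrite !nth_default ?s0.
  by apply: sorted_undup => //; rewrite -(prednK s0) ltnS.
- by move=> i; exact/dz/a0.
- move=> t tS; have ts : t \in s by rewrite mem_sort mem_undup.
  exists (index t s); last by rewrite nth_index.
  by move: ts; rewrite -index_mem; case: (size s).
Qed.

(** The slope [t] is some [a i] and [xs] is [z i], so hinges before [i] are active to its right and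
    those from [i] on inactive to its left. *)
Lemma disc_slopes (R : realType) (p : R -> R) (S : seq R) (t xs : R) :
  pricing1 p -> (forall x, 0 <= x <= 1 -> lower_cont p x) ->
  (forall u, u \in S -> 0 <= u) -> t \in S -> demand_point p t xs ->
  let q := disc (convhull1 p) S in
  [/\ p xs <= q xs,
      forall x y, 0 <= x -> x <= y -> y <= xs -> q y - q x <= t * (y - x) &
      forall x, xs <= x -> t * (x - xs) <= q x - q xs].
Proof.
move=> pp lsc S0 tS dxs q; have [_ p0 _] := pp.
have [k [a [z [qE _ mono dz Sa]]]] := disc_convhull1_hinge_sum pp lsc S0.
have [i ik ti] := Sa _ tS.
have zi : z i = xs.
  by rewrite -(ell_convhull1 (dz i)) -(ell_convhull1 dxs) ti.
have am j : (j < k)%N -> a j <= a j.+1.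
  by move=> jk; have [] := mono j j.+1; rewrite ?leqnSn.
have qh x : 0 <= x -> q x = hinge_sum k a z x.
  by move=> x0; rewrite /q qE /= max_r.
have z0 j : 0 <= z j by have [/andP[]] := dz j.
have slope j x y : (j <= k)%N -> (forall l, (l < j)%N -> z l <= x) -> 0 <= x ->
    x <= y -> a j * (y - x) <= q y - q x.
  move=> jk zx x0 xy; rewrite !qh//; last exact: le_trans xy.
  exact: hinge_sum_diff_ge.
have zx j l : (j <= k)%N -> (l < j)%N -> z l <= z j.
  by move=> jk lj; have [] := mono l j; rewrite ?jk ?(ltnW lj).
split.
(* Induction along the breakpoints, starting from 0: up to [z i.+1], [q] rises at rate at least
   [a i.+1], while optimality of [z i.+1] for that slope bounds the rise of [p] by the same rate. *)
- rewrite -zi {ti zi dxs}; elim: i ik => [|i IH] ik.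
    have := slope 0%N 0 (z 0%N) ik; rewrite lexx.
    move=> /(_ (fun l (l0 : (l < 0)%N) => False_ind _ (notF l0)) isT (z0 _)).
    have [_ + _] := dz 0%N => /(_ 0); rewrite lexx ler01 => /(_ isT).
    rewrite p0 (qh 0)// /hinge_sum mulr0 add0r big1; first by lra.
    by move=> j _; rewrite max_l ?mulr0// sub0r oppr_le0.
  have zii : z i <= z i.+1 by apply: zx.
  have := slope i.+1 (z i) (z i.+1) ik.
  have zl l : (l < i.+1)%N -> z l <= z i.
    rewrite ltnS leq_eqVlt => /orP[/eqP->//|li]; apply: zx => //; exact: ltnW.
  move=> /(_ zl (z0 _) zii); have := IH (ltnW ik).
  have [zi01 _ _] := dz i.
  have [_ + _] := dz i.+1 => /(_ _ zi01); lra.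
- move=> x y x0 xy yx; rewrite !qh//; last exact: le_trans xy.
  rewrite ti; apply: hinge_sum_diff_le => // j /andP[ij jk].
  apply: (le_trans yx); rewrite -zi.
  by have [] := mono i j; rewrite ?ij ?(ltnW jk).
- move=> x xsx; rewrite ti; apply: slope => // [l li|].
    by rewrite -zi; exact: zx.
  by rewrite -zi.
Qed.

Lemma disc_regular (R : realType) (p : R -> R) (S : seq R) :
  pricing1 p -> (forall x, 0 <= x <= 1 -> lower_cont p x) ->
  (forall u, u \in S -> 0 <= u) ->
  let q := disc (convhull1 p) S in
  [/\ q 0 = 0, continuous q, nondecr01 q, convex01 q & piecewise_linear01 q].
Proof.
move=> pp lsc S0 q.
have [k [a [z [qE a0 mono dz _]]]] := disc_convhull1_hinge_sum pp lsc S0.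
have am j : (j < k)%N -> a j <= a j.+1.
  by move=> jk; have [] := mono j j.+1; rewrite ?leqnSn.
have qh x : 0 <= x -> q x = hinge_sum k a z x.
  by move=> x0; rewrite /q qE /= max_r.
have z01 i : 0 <= z i <= 1 by have [] := dz i.
split.
- rewrite qh// /hinge_sum mulr0 add0r big1// => j _.
  by rewrite max_l ?mulr0// sub0r oppr_le0; have /andP[] := z01 j.
- move=> x; rewrite /q qE; apply: continuous_comp; last exact: hinge_sum_continuous.
  by apply: (@continuous_max R R (fun=> 0) id x); [exact: cvg_cst|exact: cvg_id].
- move=> x y x0 xy _; rewrite !qh//; last exact: le_trans xy.
  rewrite -subr_ge0; apply: (@le_trans _ _ (a 0%N * (y - x))).
    by rewrite mulr_ge0// subr_ge0.
  exact: hinge_sum_diff_ge.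
- move=> x y t x01 y01 t01; rewrite !qh; first exact: hinge_sum_convex.
  + by have /andP[] := y01.
  + by have /andP[] := x01.
  + have /andP[x0 _] := x01; have /andP[y0 _] := y01; have /andP[t0 t1] := t01.
    by rewrite addr_ge0// mulr_ge0// subr_ge0.
- have [] := hinge_sum_piecewise_linear am _ (fun i _ => z01 i).
    by move=> i j /andP[ij jk]; have [] := mono i j; rewrite ?ij ?(ltnW jk).
  (* Nonnegative breakpoints keep every piece where [q] agrees with the hinge sum. *)
  move=> n [t [t0 tn tm lin]]; have tpos i : (i <= n)%N -> 0 <= t i.
    elim: i => [|i IH] ilt; first by rewrite t0.
    exact: le_trans (IH (ltnW ilt)) (tm _ ilt).
  exists n, t; split => // i /[dup] ilt /lin[c [d E]].
  exists c, d => x xt; rewrite qh ?E//; have /andP[tx _] := xt.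
  by apply: le_trans tx; exact/tpos/ltnW.
Qed.

Unset Implicit Arguments.

Theorem mainTheorem2 (R : realType) (n m : nat) (b : 'I_n -> R)
    (tau : 'I_n -> 'I_m -> R) (p : 'I_m -> R -> R) :
  (forall i, 0 <= b i) ->
  (forall i j, 0 <= tau i j) ->
  (forall j, pricing1 (p j)) ->
  (forall j x, 0 <= x <= 1 -> lower_cont (p j) x) ->
  let phat j := disc (convhull1 (p j)) [seq tau i j | i <- enum 'I_n] in
  let P (x : 'I_m -> R) := \sum_(j < m) p j (x j) in
  let Phat (x : 'I_m -> R) := \sum_(j < m) phat j (x j) in
  (forall i, (revenue P (linval (tau i)) (b i) <= revenue Phat (linval (tau i)) (b i))%E)
  /\
  (forall j, [/\ nondecr01 (phat j),
                 {within `[0, 1], continuous (phat j)},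
                 convex01 (phat j) & piecewise_linear01 (phat j)]).
Proof.
move=> b0 tau0 pp lsc phat P Phat.
have S0 j u : u \in [seq tau i j | i <- enum 'I_n] -> 0 <= u.
  by move=> /mapP[i _ ->].
have reg j := disc_regular (pp j) (lsc j) (@S0 j).
split=> [i|j]; last first.
  have [_ cq mq vq lq] := reg j.
  by split => //; exact: continuous_subspaceT.
pose L j := sval (cid (demand_point_exists (pp j) (lsc j) (tau0 i j))).
have dL j : demand_point (p j) (tau i j) (L j) by exact: svalP (cid _).
have tS j : tau i j \in [seq tau i j | i <- enum 'I_n].
  by apply/mapP; exists i; rewrite ?mem_enum.
have sl j := disc_slopes (pp j) (lsc j) (@S0 j) (tS j) (dL j).
apply: (revenue_dominated (L := L)) => //.
- by move=> j; have [] := pp j.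
- by move=> j; have [] := reg j.
- by move=> j; have [] := reg j.
- by move=> j; have [] := reg j.
- by move=> j; have [] := sl j.
- by move=> j; have [] := sl j.
- by move=> j x xL _; have [_ _ H] := sl j; exact: H xL.
Qed.
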